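(* Let $n\in\mathbb{N}$ and $\varepsilon>0$. There exists $w\in\mathbb{F}_2\setminus\{e\}$ such that $$\|1_n-w(u,v)\|\leq\varepsilon\quad\text{for all } u,v\in U(n).$$
   Context: $\mathbb{F}_2$ is the free group on two generators $a,b$, with neutral element $e$. $U(n)$ is the group of unitary $n\times n$ complex matrices, $1_n$ is the identity matrix and $\|\cdot\|$ is the operator norm. For $w\in\mathbb{F}_2$, $w\colon U(n)\times U(n)\to U(n)$ denotes the word map obtained by evaluating $w$: $w(u,v)$ is the image of $w$ under the homomorphism $\mathbb{F}_2\to U(n)$ with $a\mapsto u$, $b\mapsto v$. *)

(* Defs.v *)
From HB Require Import structures.
From mathcomp Require Import all_boot all_order all_algebra.
From mathcomp Require Import all_classical reals.
From mathcomp Require Import complex.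
Set Implicit Arguments.
Unset Strict Implicit.
Unset Printing Implicit Defensive.
Import Order.TTheory GRing.Theory Num.Theory.
Local Open Scope ring_scope.

(* A letter (g, s) is the generator a if g = false and b if g = true, with    *)
(* exponent -1 if s = true and 1 if s = false.                                *)
Notation letter := (bool * bool)%type.

Definition inv_letter (x : letter) : letter := (x.1, ~~ x.2).

Lemma inv_letterK : involutive inv_letter.
Proof. by case=> g s; rewrite /inv_letter /= negbK. Qed.

Definition reduced : pred (seq letter) := sorted (fun x y => y != inv_letter x).

Record F2 := FreeWord { word :> seq letter; word_reduced : reduced word }.
HB.instance Definition _ := [isSub for word].
HB.instance Definition _ := [Countable of F2 by <:].

(* The reduced form of x :: s, for s reduced. *)
Definition push (x : letter) (s : seq letter) : seq letter :=
  if s is y :: s' then if y == inv_letter x then s' else x :: s else [:: x].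

Definition mulw (s t : seq letter) : seq letter := foldr push t s.

Definition invw (s : seq letter) : seq letter := rev (map inv_letter s).

Lemma reduced_behead x s : reduced (x :: s) -> reduced s.
Proof. by case: s => //= y s /andP[]. Qed.

Lemma push_reduced x s : reduced s -> reduced (push x s).
Proof.
case: s => // y s red_s; rewrite /push; case: ifPn => [_|y_x].
  exact: reduced_behead red_s.
by rewrite /reduced /= y_x.
Qed.

Lemma push_cons x s : reduced (x :: s) -> push x s = x :: s.
Proof. by case: s => //= y s /andP[/negPf->]. Qed.

Lemma pushK x s : reduced s -> push x (push (inv_letter x) s) = s.
Proof.
case: s => [|y s] red_s; first by rewrite /= eqxx.
rewrite [X in push x X]/=; case: eqP => [y_x|_]; last by rewrite /= eqxx.
by move: red_s; rewrite y_x inv_letterK => /push_cons.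
Qed.

Lemma pushVK x s : reduced s -> push (inv_letter x) (push x s) = s.
Proof. by move/(pushK (inv_letter x)); rewrite inv_letterK. Qed.

Lemma mulw_reduced s t : reduced t -> reduced (mulw s t).
Proof. by move=> red_t; elim: s => //= x s; apply: push_reduced. Qed.

Lemma mulw_push x s t : reduced t -> mulw (push x s) t = push x (mulw s t).
Proof.
move=> red_t; case: s => //= y s.
by case: eqP => [->|//]; rewrite pushK ?mulw_reduced.
Qed.

Lemma mulwA s t u : reduced u -> mulw s (mulw t u) = mulw (mulw s t) u.
Proof. by move=> red_u; elim: s => //= x s ->; rewrite mulw_push. Qed.

Lemma mulws0 s : reduced s -> mulw s [::] = s.
Proof.
elim: s => //= x s IHs red_xs.
by rewrite IHs ?(reduced_behead red_xs)// push_cons.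
Qed.

Lemma mulw_cat s t u : mulw (s ++ t) u = mulw s (mulw t u).
Proof. exact: foldr_cat. Qed.

Lemma mulVw s t : reduced t -> mulw (invw s) (mulw s t) = t.
Proof.
move=> red_t; elim: s => //= x s IHs.
by rewrite /invw /= rev_cons -cats1 mulw_cat /= pushVK ?mulw_reduced.
Qed.

Lemma invwK : involutive invw.
Proof.
move=> s; rewrite /invw -map_rev revK -map_comp map_id_in// => x.
by rewrite /= inv_letterK.
Qed.

Lemma mulwV s t : reduced t -> mulw s (mulw (invw s) t) = t.
Proof. by rewrite -{1}[s]invwK; apply: mulVw. Qed.

Lemma invw_reduced s : reduced s -> reduced (invw s).
Proof.
rewrite /reduced /invw rev_sorted sorted_map; apply: sub_sorted => x y /=.
by apply: contra => /eqP ->; rewrite !inv_letterK.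
Qed.

Definition F2_one : F2 := @FreeWord [::] isT.
Definition F2_mul (s t : F2) : F2 :=
  FreeWord (mulw_reduced s (word_reduced t)).
Definition F2_inv (s : F2) : F2 := FreeWord (invw_reduced (word_reduced s)).

Lemma F2_mulA : associative F2_mul.
Proof. by move=> s t u; apply/val_inj/mulwA/word_reduced. Qed.
Lemma F2_mul1 : left_id F2_one F2_mul.
Proof. by move=> s; apply/val_inj. Qed.
Lemma F2_mulr1 : right_id F2_one F2_mul.
Proof. by move=> s; apply/val_inj/mulws0/word_reduced. Qed.
Lemma F2_mulV : left_inverse F2_one F2_inv F2_mul.
Proof.
move=> s; apply/val_inj; rewrite /= -{2}(mulws0 (word_reduced s)).
exact: mulVw.
Qed.
Lemma F2_mulrV : right_inverse F2_one F2_inv F2_mul.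
Proof.
move=> s; apply/val_inj.
rewrite /= -[invw s](mulws0 (invw_reduced (word_reduced s))).
exact: mulwV.
Qed.
HB.instance Definition _ :=
  isGroup.Build F2 F2_mulA F2_mul1 F2_mulr1 F2_mulV F2_mulrV.

Definition F2_a : F2 := @FreeWord [:: (false, false)] isT.
Definition F2_b : F2 := @FreeWord [:: (true, false)] isT.

Section WordMap.
Variable G : groupType.
Implicit Types (u v : G) (x : letter) (s : seq letter) (w : F2).
Local Open Scope group_scope.

Definition eval_letter u v x : G :=
  let g := if x.1 then v else u in if x.2 then g^-1 else g.

Definition eval_word u v s : G := \prod_(x <- s) eval_letter u v x.

Definition word_map w u v : G := eval_word u v w.

(* The next lemmas show that w |-> word_map w u v is the unique homomorphism  *)
(* from F2 to G sending a to u and b to v; in particular F2 is free on a, b.  *)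

Lemma eval_inv_letter u v x :
  eval_letter u v (inv_letter x) = (eval_letter u v x)^-1.
Proof. by case: x => g [] /=; rewrite /eval_letter /= ?invgK. Qed.

Lemma eval_push u v x s :
  eval_word u v (push x s) = eval_letter u v x * eval_word u v s.
Proof.
rewrite /eval_word; case: s => [|y s]; first by rewrite big_cons.
rewrite /=; case: eqP => [->|_]; last by rewrite big_cons.
by rewrite big_cons eval_inv_letter mulVKg.
Qed.

Lemma word_mapM u v w1 w2 :
  word_map (w1 * w2) u v = word_map w1 u v * word_map w2 u v.
Proof.
rewrite /word_map [word _]/=; elim: (word w1) => [|x s IHs] /=.
  by rewrite [X in X * _]big_nil mul1g.
by rewrite eval_push IHs mulgA [in RHS]/eval_word big_cons.
Qed.

Lemma word_map1 u v : word_map 1 u v = 1.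
Proof. exact: big_nil. Qed.

Lemma word_map_a u v : word_map F2_a u v = u.
Proof. by rewrite /word_map /eval_word big_seq1. Qed.

Lemma word_map_b u v : word_map F2_b u v = v.
Proof. by rewrite /word_map /eval_word big_seq1. Qed.

Lemma word_map_unique u v (f : F2 -> G) :
    {morph f : w1 w2 / w1 * w2} -> f F2_a = u -> f F2_b = v ->
  f =1 fun w => word_map w u v.
Proof.
move=> fM fa fb.
have f1 : f 1 = 1 by apply: (mulIg (f 1)); rewrite -fM !mul1g.
have fV w : f w^-1 = (f w)^-1 by apply: (mulIg (f w)); rewrite -fM !mulVg.
move=> [s]; rewrite /word_map /=; elim: s => [|x s IHs] red_s.
  by rewrite /eval_word big_nil -f1; congr f; apply: val_inj.
have red_x : reduced [:: x] by [].
have -> : FreeWord red_s = FreeWord red_x * FreeWord (reduced_behead red_s).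
  by apply: val_inj; rewrite /= push_cons.
rewrite fM IHs /eval_word big_cons; congr (_ * _).
case: x {IHs red_s} red_x => [[] []] red_x; rewrite /eval_letter /= -?fa -?fb -?fV;
  by congr f; apply: val_inj.
Qed.

End WordMap.

Section Unitary.
Variables (R : realType) (n : nat).

Record unitary := Unitary {
  umx :> 'M[R[i]]_n;
  umx_unitary : umx \is unitarymx }.
HB.instance Definition _ := [isSub for umx].
HB.instance Definition _ := [Choice of unitary by <:].

Implicit Types u v w : unitary.
Local Open Scope sesquilinear_scope.

Fact unitary1 : (1%:M : 'M[R[i]]_n) \is unitarymx.
Proof. by apply/unitarymxP; rewrite trmx1 map_mx1 mulmx1. Qed.

Fact unitaryV u : (umx u)^t* \is unitarymx.
Proof. by rewrite trmxC_unitary umx_unitary. Qed.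

Definition U_one := Unitary unitary1.
Definition U_mul u v := Unitary (mul_unitarymx (umx_unitary u) (umx_unitary v)).
Definition U_inv u := Unitary (unitaryV u).

Fact U_mulA : associative U_mul.
Proof. by move=> u v w; apply/val_inj/mulmxA. Qed.
Fact U_mul1 : left_id U_one U_mul.
Proof. by move=> u; apply/val_inj/mul1mx. Qed.
Fact U_mulr1 : right_id U_one U_mul.
Proof. by move=> u; apply/val_inj/mulmx1. Qed.
Fact U_mulrV : right_inverse U_one U_inv U_mul.
Proof. by move=> u; apply/val_inj/unitarymxP/umx_unitary. Qed.
Fact U_mulV : left_inverse U_one U_inv U_mul.
Proof. by move=> u; apply/val_inj/mulmx1C/unitarymxP/umx_unitary. Qed.
HB.instance Definition _ :=
  isGroup.Build unitary U_mulA U_mul1 U_mulr1 U_mulV U_mulrV.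

End Unitary.

Section OperatorNorm.
Variable R : realType.
Local Open Scope classical_set_scope.

Definition l2norm n (x : 'cV[R[i]]_n) : R :=
  Num.sqrt (\sum_i Normc.normc (x i 0) ^+ 2).

(* The supremum is over the unit ball rather than the unit sphere so that the *)
(* set is nonempty also for n = 0; it is bounded by has_sup_opnorm.           *)
Definition opnorm n (A : 'M[R[i]]_n) : R :=
  sup [set l2norm (A *m x) | x in [set x | l2norm x <= 1]].

Lemma normc_ge0 (z : R[i]) : 0 <= Normc.normc z.
Proof. by case: z => a b; apply: sqrtr_ge0. Qed.

Lemma normc_le_l2norm n (x : 'cV[R[i]]_n) i : Normc.normc (x i 0) <= l2norm x.
Proof.
rewrite -(ger0_norm (normc_ge0 _)) -sqrtr_sqr; apply: ler_wsqrtr.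
by rewrite (bigD1 i)//= lerDl; apply: sumr_ge0 => j _; apply: sqr_ge0.
Qed.

Lemma has_sup_opnorm n (A : 'M[R[i]]_n) :
  has_sup [set l2norm (A *m x) | x in [set x | l2norm x <= 1]].
Proof.
split.
  exists (l2norm (A *m 0)), 0 => //=; rewrite /l2norm big1 ?sqrtr0 ?ler01// => i _.
  by rewrite mxE Normc.normc0 expr0n.
exists (Num.sqrt (\sum_i (\sum_j Normc.normc (A i j)) ^+ 2)) => _ [x /= x1 <-].
apply: ler_wsqrtr; apply: ler_sum => i _.
rewrite lerXn2r ?nnegrE ?normc_ge0//; first by apply: sumr_ge0 => j _; apply: normc_ge0.
rewrite mxE; apply: (@le_trans _ _ (\sum_j Normc.normc (A i j * x j 0))).
  elim/big_rec2: _ => [|j y1 y2 _ le_y]; first by rewrite Normc.normc0.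
  by apply: le_trans (le_normcD _ _) _; rewrite lerD2l.
apply: ler_sum => j _; rewrite Normc.normcM ler_piMr ?normc_ge0//.
exact: le_trans (normc_le_l2norm _ _) x1.
Qed.

End OperatorNorm.

(* Main.v *)
Require Import Defs.
From mathcomp Require Import all_boot all_order all_algebra.
From mathcomp Require Import all_classical reals.
From mathcomp Require Import complex.
From mathcomp Require Import ring lra.
Set Implicit Arguments.
Unset Strict Implicit.
Unset Printing Implicit Defensive.
Import Order.TTheory GRing.Theory Num.Theory.
Local Open Scope ring_scope.

(** Write l(u) for the distance of the unitary u to the identity in operator
    norm. Then l is invariant under conjugation, l(u) <= 2, and commutators
    contract: l([u, v]) <= 2 l(u) l(v) (lemmas [dist1J], [dist1_le2], [dist1R]).
    As U(n) is totally bounded, two of the powers u^0, ..., u^m are close to each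
    other once m is large, so there is a fixed m such that every u satisfies
    l(u^k) <= 1/4 for some k in 1, ..., m (lemma [dist1_expg_le]).

    The exponent k depends on u, and a single word has to serve all pairs (u, v).
    For each k, start from the word a^k and iterate t times the passage from z
    to a commutator of two conjugates of z: at the pairs where l(u^k) <= 1/4
    every step at least halves the bound on l, so there the resulting word c_k
    takes a value with l at most 2^-t / 4 (lemma [exists_contracting_word]).
    Finally combine c_1, ..., c_m into one iterated commutator w. By l([x, y]) <= 4 l(x) and
    l([x, y]) <= 4 l(y), the distance of the value of w to the identity is at most
    4^m times the smallest of those of the c_k (lemma [exists_dominated_word]),
    hence at most 4^m 2^-t / 4 at every pair. Since m was fixed before t, this tends to 0 as t
    grows.

    The words stay nontrivial because, for nontrivial x and y in the free
    group on a and b, some conjugate of x fails to commute with some conjugate of y (lemma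
    [exists_noncommuting_conj]); passing to conjugates is harmless for l. *)

(** * Euclidean norm and operator norm *)

Section L2norm.
Variables (R : realType) (n : nat).
Implicit Types (c : R) (z : R[i]) (x y : 'cV[R[i]]_n) (A : 'M[R[i]]_n).
Implicit Types (u v : unitary R n).
Local Open Scope complex_scope.
Local Open Scope sesquilinear_scope.
Notation normc := Normc.normc.

Lemma l2norm_ge0 x : 0 <= l2norm x.
Proof. exact: sqrtr_ge0. Qed.

Lemma sqr_l2norm x : l2norm x ^+ 2 = \sum_i normc (x i 0) ^+ 2.
Proof. by rewrite sqr_sqrtr// sumr_ge0// => i _; rewrite sqr_ge0. Qed.

Lemma sqr_normcE z : normc z ^+ 2 = complex.Re z ^+ 2 + complex.Im z ^+ 2.
Proof. by case: z => a b /=; rewrite sqr_sqrtr// addr_ge0 ?sqr_ge0. Qed.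

Lemma l2normZ z x : l2norm (z *: x) = normc z * l2norm x.
Proof.
rewrite -[normc z]ger0_norm ?normc_ge0// -sqrtr_sqr -sqrtrM ?sqr_ge0// mulr_sumr.
by congr Num.sqrt; apply: eq_bigr => i _; rewrite mxE Normc.normcM exprMn.
Qed.

Lemma l2norm_eq0 x : l2norm x = 0 -> x = 0.
Proof.
move=> x0; apply/colP => i; rewrite mxE; apply: Normc.eq0_normc.
by apply/le_anti; rewrite normc_ge0 -x0 normc_le_l2norm.
Qed.

Lemma sqr_l2norm_dot x : (l2norm x ^+ 2)%:C = (x^t* *m x) 0 0.
Proof.
rewrite sqr_l2norm rmorph_sum mxE; apply: eq_bigr => i _.
by rewrite !mxE mulrC -sqr_normc rmorphXn /=; case: (x i 0).
Qed.

Lemma l2norm_unitary u x : l2norm (umx u *m x) = l2norm x.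
Proof.
apply/eqP; rewrite -(eqrXn2 (n := 2))// ?l2norm_ge0//.
apply/eqP/(@complexI R); rewrite !sqr_l2norm_dot trmx_mul map_mxM -!mulmxA.
have /mulmx1C : umx u *m (umx u)^t* = 1%:M by apply/unitarymxP/umx_unitary.
by rewrite [_ *m (_ *m x)]mulmxA => ->; rewrite mul1mx.
Qed.

(** Half of the parallelogram law. For two vectors with a common bound it is as
    sharp as the triangle inequality, see [l2normB_le]. *)
Lemma l2normB_sqr x y :
  l2norm (x - y) ^+ 2 <= 2 * l2norm x ^+ 2 + 2 * l2norm y ^+ 2.
Proof.
rewrite !sqr_l2norm !mulr_sumr -big_split; apply: ler_sum => i _.
rewrite !mxE !sqr_normcE; case: (x i 0) (y i 0) => [a b] [c d] /=.
(* The difference of the two sides is |x + y|^2 at this coordinate. *)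
rewrite -subr_ge0; apply: le_trans (addr_ge0 (sqr_ge0 (a + c)) (sqr_ge0 (b + d))) _.
by rewrite le_eqVlt; apply/orP; left; apply/eqP; ring.
Qed.

Lemma l2normB_le c x y :
  l2norm x <= c -> l2norm y <= c -> l2norm (x - y) <= 2 * c.
Proof.
move=> le_xc le_yc; have c_ge0 : 0 <= c := le_trans (l2norm_ge0 x) le_xc.
have le_sqr (z : 'cV[R[i]]_n) : l2norm z <= c -> l2norm z ^+ 2 <= c ^+ 2.
  by move=> le_zc; rewrite lerXn2r ?nnegrE ?l2norm_ge0.
rewrite -(ler_pXn2r (n := 2)) ?nnegrE ?l2norm_ge0 ?mulr_ge0//.
apply: le_trans (l2normB_sqr _ _) _.
have := lerD (le_sqr _ le_xc) (le_sqr _ le_yc).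
by rewrite exprMn; lra.
Qed.

Lemma opnorm_le c A : 0 <= c ->
  (forall x, l2norm (A *m x) <= c * l2norm x) -> opnorm A <= c.
Proof.
move=> c_ge0 le_c; apply: ge_sup; first by case: (has_sup_opnorm A).
by move=> _ [x /= x1 <-]; apply: le_trans (le_c x) _; rewrite ler_piMr.
Qed.

Lemma le_opnorm A x : l2norm x <= 1 -> l2norm (A *m x) <= opnorm A.
Proof. by move=> x1; apply: sup_upper_bound (has_sup_opnorm A) _ _; exists x. Qed.

Lemma l2norm_mulmx_le A x : l2norm (A *m x) <= opnorm A * l2norm x.
Proof.
have [x0|x_neq0] := eqVneq (l2norm x) 0.
  by rewrite (l2norm_eq0 x0) mulmx0 -(scale0r 0) l2normZ Normc.normc0 !mul0r mulr0.
have x_gt0 : 0 < l2norm x by rewrite lt0r x_neq0 l2norm_ge0.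
have normcV : normc ((l2norm x)^-1)%:C = (l2norm x)^-1.
  by rewrite /= expr0n addr0 sqrtr_sqr ger0_norm ?invr_ge0 ?l2norm_ge0.
have := @le_opnorm A (((l2norm x)^-1)%:C *: x).
rewrite -scalemxAr !l2normZ normcV mulVf// lexx => /(_ isT).
by rewrite ler_pdivrMl// mulrC.
Qed.

Lemma opnorm_ge0 A : 0 <= opnorm A.
Proof.
apply: le_trans (l2norm_ge0 (A *m 0)) (le_opnorm _ _).
by rewrite -(scale0r 0) l2normZ Normc.normc0 mul0r ler01.
Qed.

(** The constant is crude; what matters is that entrywise closeness, which the
    pigeonhole principle provides, implies closeness in operator norm. *)
Lemma opnorm_le_entries c A : 0 <= c -> (forall i j, normc (A i j) <= c) ->
  opnorm A <= c * n%:R ^+ 2.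
Proof.
move=> c_ge0 le_Ac; apply: opnorm_le => [|x]; first by rewrite mulr_ge0 ?exprn_ge0.
have le_Ax i : normc ((A *m x) i 0) <= c * n%:R * l2norm x.
  rewrite mxE; apply: (@le_trans _ _ (\sum_j normc (A i j * x j 0))).
    elim/big_rec2: _ => [|j y1 y2 _ le_y]; first by rewrite Normc.normc0.
    by apply: le_trans (le_normcD _ _) _; rewrite lerD2l.
  have -> : c * n%:R * l2norm x = \sum_(j < n) c * l2norm x.
    by rewrite sumr_const card_ord mulrAC mulr_natr.
  apply: ler_sum => j _; rewrite Normc.normcM.
  by rewrite ler_pM ?normc_ge0 ?normc_le_l2norm.
have c'_ge0 : 0 <= c * n%:R * l2norm x.
  by rewrite !mulr_ge0 ?l2norm_ge0.
rewrite -(ler_pXn2r (n := 2)) ?nnegrE ?mulr_ge0 ?exprn_ge0 ?l2norm_ge0//.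
rewrite sqr_l2norm.
apply: (@le_trans _ _ (\sum_(i < n) (c * n%:R * l2norm x) ^+ 2)).
  by apply: ler_sum => i _; rewrite lerXn2r ?nnegrE ?normc_ge0.
have -> : c * n%:R ^+ 2 * l2norm x = c * n%:R * l2norm x * n%:R by ring.
rewrite sumr_const -[leLHS]mulr_natr card_ord [in leRHS]exprMn ler_wpM2l ?sqr_ge0//.
by rewrite -natrX ler_nat; case: (n) => // m; rewrite leq_pmulr.
Qed.

End L2norm.

(** * Distance to the identity in the unitary group *)

Section Dist1.
Variables (R : realType) (n : nat).
Implicit Types (c : R) (x y : 'cV[R[i]]_n) (u v : unitary R n).
Local Open Scope complex_scope.
Notation normc := Normc.normc.

Definition dist1 u : R := opnorm (1%:M - umx u).

Lemma dist1_ge0 u : 0 <= dist1 u.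
Proof. exact: opnorm_ge0. Qed.

Lemma dist1_le c u : 0 <= c ->
  (forall x, l2norm (x - umx u *m x) <= c * l2norm x) -> dist1 u <= c.
Proof. by move=> c_ge0 le_c; apply: opnorm_le => // x; rewrite mulmxBl mul1mx. Qed.

Lemma l2norm_sub_unitary u x : l2norm (x - umx u *m x) <= dist1 u * l2norm x.
Proof. by rewrite -{1}[x]mul1mx -mulmxBl l2norm_mulmx_le. Qed.

Lemma umxM u v : umx (u * v)%g = umx u *m umx v. Proof. by []. Qed.

Lemma dist1_le2 u : dist1 u <= 2.
Proof. by apply: dist1_le => // x; apply: l2normB_le; rewrite ?l2norm_unitary. Qed.

Lemma dist1J u v : dist1 (u ^ v)%g <= dist1 u.
Proof.
apply: dist1_le (dist1_ge0 u) _ => x.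
rewrite -(l2norm_unitary v) mulmxBr mulmxA -umxM -conjgC umxM -mulmxA.
by rewrite -(l2norm_unitary v x) l2norm_sub_unitary.
Qed.

(** Up to a unitary factor, 1 - [u, v] is the additive commutator v u - u v,
    which equals (1 - v) (1 - u) - (1 - u) (1 - v): a difference of two products
    that are both bounded by l(u) l(v), where l is [dist1]. *)
Lemma dist1R u v : dist1 [~ u, v]%g <= 2 * (dist1 u * dist1 v).
Proof.
apply: dist1_le => [|x]; first by rewrite !mulr_ge0 ?dist1_ge0.
rewrite -(l2norm_unitary (v * u)%g) mulmxBr mulmxA -umxM -commgC.
have -> : umx (v * u)%g *m x - umx (u * v)%g *m x
        = (x - umx u *m x - umx v *m (x - umx u *m x))
          - (x - umx v *m x - umx u *m (x - umx v *m x)).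
  rewrite !umxM !mulmxBr -!mulmxA.
  move: (umx v *m (_ *m _)) (umx u *m (_ *m _)) => a b.
  move: (umx u *m x) (umx v *m x) => c d.
  by apply/colP => i; rewrite !mxE; ring.
rewrite -mulrA; apply: l2normB_le; apply: le_trans (l2norm_sub_unitary _ _) _.
  rewrite [in leRHS](mulrC (dist1 u)) -[leRHS]mulrA.
  exact: ler_wpM2l (dist1_ge0 _) _ _ (l2norm_sub_unitary _ _).
rewrite -[leRHS]mulrA.
exact: ler_wpM2l (dist1_ge0 _) _ _ (l2norm_sub_unitary _ _).
Qed.

(** * Recurrence of the powers of a unitary matrix *)

Lemma truncn_eq_dist (a b : R) : 0 <= a -> 0 <= b ->
  Num.truncn a = Num.truncn b -> `|a - b| <= 1.
Proof.
move=> /truncn_itv/andP[la ua] /truncn_itv/andP[lb ub] ab.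
by rewrite ab in la ua; rewrite ler_norml; move: la ua lb ub; rewrite -natr1; lra.
Qed.

Lemma normc_le_ReIm (z : R[i]) :
  normc z <= `|complex.Re z| + `|complex.Im z|.
Proof.
rewrite -(ler_pXn2r (n := 2)) ?nnegrE ?normc_ge0 ?addr_ge0//.
rewrite sqr_normcE sqrrD !real_normK ?num_real//.
by rewrite lerD2r lerDl mulrn_wge0 ?mulr_ge0.
Qed.

Lemma absRe_le_normc (z : R[i]) : `|complex.Re z| <= normc z.
Proof.
rewrite -(ler_pXn2r (n := 2)) ?nnegrE ?normc_ge0//.
by rewrite sqr_normcE real_normK ?num_real// lerDl sqr_ge0.
Qed.

Lemma absIm_le_normc (z : R[i]) : `|complex.Im z| <= normc z.
Proof.
rewrite -(ler_pXn2r (n := 2)) ?nnegrE ?normc_ge0//.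
by rewrite sqr_normcE real_normK ?num_real// lerDr sqr_ge0.
Qed.

Lemma normc_unitary_le1 u i j : normc (umx u i j) <= 1.
Proof.
apply: (@le_trans _ _ (l2norm (umx u *m (delta_mx j 0 : 'cV_n)))).
  by rewrite -colE; apply: le_trans (normc_le_l2norm _ i); rewrite mxE.
rewrite l2norm_unitary -(ler_pXn2r (n := 2)) ?nnegrE ?l2norm_ge0// sqr_l2norm.
rewrite (bigD1 j)//= big1 => [|k /negPf kj].
  by rewrite addr0 mxE !eqxx Normc.normc1.
by rewrite mxE kj Normc.normc0 expr0n.
Qed.

(** Pigeonhole: cut the square [-1, 1]^2, which contains every entry of a unitary
    matrix, into cells of side 1/K. Among more powers of u than there are
    distributions of entries over cells, two powers u^i and u^j with i < j agree
    in all cells, hence are close; multiplying by u^-i shows that u^(j-i) is close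
    to 1. The number of powers needed does not depend on u. *)
Lemma dist1_expg_le (d : R) : 0 < d ->
  exists m, forall u, exists2 k, (0 < k <= m)%N & dist1 (u ^+ k)%g <= d.
Proof.
move=> d_gt0.
(* Entries in the same cell are at distance at most 2 / K, hence by
   opnorm_le_entries the matrices are at distance at most 2 n^2 / K <= d. *)
have [K K_gt0 K_gt] : exists2 K : nat, 0 < K%:R :> R & 2 * n%:R ^+ 2 / d < K%:R.
  by exists (Num.truncn (2 * n%:R ^+ 2 / d)).+1; rewrite ?ltr0n ?truncnS_gt.
pose T := {ffun 'I_n * 'I_n -> 'I_(K.*2).+1 * 'I_(K.*2).+1}.
pose coord (a : R) : 'I_(K.*2).+1 := inord (Num.truncn ((a + 1) * K%:R)).
pose cell (u : unitary R n) : T :=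
  [ffun ij => let z := umx u ij.1 ij.2 in
              (coord (complex.Re z), coord (complex.Im z))].
have coordP (a b : R) : `|a| <= 1 -> `|b| <= 1 -> coord a = coord b ->
    `|a - b| <= K%:R^-1.
  have bounds (c : R) : `|c| <= 1 -> 0 <= (c + 1) * K%:R < (K.*2).+1%:R.
    rewrite ler_norml => /andP[c_ge c_le]; apply/andP; split.
      by rewrite mulr_ge0 ?(ltW K_gt0)// -lerBlDr sub0r.
    by rewrite -natr1 -mul2n natrM ltr_pwDr// ler_wpM2r ?(ltW K_gt0)//; lra.
  move=> /bounds/andP[a_ge a_lt] /bounds/andP[b_ge b_lt] /(congr1 val).
  rewrite /= !inordK ?truncn_lt_nat// => /(truncn_eq_dist a_ge b_ge).
  rewrite -mulrBl opprD addrACA subrr addr0 normrM (ger0_norm (ltW K_gt0)).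
  by rewrite -ler_pdivlMr// mul1r.
have close u v : cell u = cell v -> opnorm (umx u - umx v) <= d.
  move=> /ffunP eq_cell; apply: (@le_trans _ _ (2 / K%:R * n%:R ^+ 2)).
    apply: opnorm_le_entries => [|i j]; first by rewrite divr_ge0.
    have := eq_cell (i, j); rewrite !ffunE /= => -[/coordP eqRe /coordP eqIm].
    have Re1 w := le_trans (absRe_le_normc _) (normc_unitary_le1 w i j).
    have Im1 w := le_trans (absIm_le_normc _) (normc_unitary_le1 w i j).
    rewrite !mxE (le_trans (normc_le_ReIm _))// mulr2n mulrDl mul1r.
    by rewrite !raddfB lerD ?eqRe ?eqIm ?Re1 ?Im1.
  by rewrite mulrAC ler_pdivrMr// [leRHS]mulrC -ler_pdivrMr// ltW.
exists #|T| => u.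
have /injectivePn[i [j neq_ij eq_ij]] :
    ~~ injectiveb (fun k : 'I_(#|T|).+1 => cell (u ^+ k)%g).
  by apply/negP => /injectiveP /leq_card; rewrite card_ord ltnn.
wlog lt_ij : i j neq_ij eq_ij / (i < j)%N.
  move=> W; have [/W|/W|/val_inj eq] := ltngtP i j; [exact|apply=> //|].
    by rewrite eq_sym.
  by rewrite eq eqxx in neq_ij.
exists (j - i)%N.
  by rewrite subn_gt0 lt_ij (leq_trans (leq_subr _ _))// -ltnS.
apply: dist1_le (ltW d_gt0) _ => x.
rewrite -(l2norm_unitary (u ^+ i)%g) mulmxBr mulmxA -umxM.
rewrite -expgnDr subnKC ?(ltnW lt_ij)//.
rewrite -mulmxBl; apply: le_trans (l2norm_mulmx_le _ _) _.
by rewrite ler_wpM2r ?l2norm_ge0 ?close.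
Qed.

End Dist1.

(** * Commutators in the free group *)

Section FreeGroup.
Local Open Scope group_scope.
Implicit Types (p q : letter) (s t : seq letter) (x y z w : F2).

Lemma mulw_reduced_cat s t : reduced (s ++ t) -> mulw s t = s ++ t.
Proof.
elim: s => //= p s IHs red_pst.
by rewrite IHs ?push_cons// (reduced_behead red_pst).
Qed.

Lemma reduced_cat s t p q :
  reduced (rcons s p) -> reduced (q :: t) -> q != inv_letter p ->
  reduced (rcons s p ++ q :: t).
Proof.
case: s => [|p0 s] /=; first by move=> _ red_qt qp; apply/andP.
by move=> red_s red_qt qp; rewrite cat_path red_s last_rcons /= qp.
Qed.

Lemma exists_letter_notin s : (size s < 4)%N -> exists q, q \notin s.
Proof.
move=> lt_s4; case: (pickP [pred q | q \notin s]) => [q q_s|s_all].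
  by exists q.
have : (4 <= size s)%N.
  rewrite (leq_trans _ (card_size s))//.
  rewrite (eq_card (B := {: letter})) ?card_prod ?card_bool// => q.
  by have /= /negbFE -> := s_all q.
by rewrite leqNgt lt_s4.
Qed.

Lemma word_mul x y : word (x * y) = mulw x y. Proof. by []. Qed.

(** The conjugate is (p q) x (p q)^-1 for an auxiliary letter q. Three conditions
    on q make the word p q x q^-1 p^-1 reduced: q must not cancel against p, nor
    against the first letter of x, and q^-1 must not cancel against the last
    letter of x. One of the four letters satisfies all of them. *)
Lemma exists_conj_framed p x : x != 1 ->
  exists g s, word (x ^ g) = p :: rcons s (inv_letter p).
Proof.
case: x => -[|f t] red_x x_neq1.
  by case/eqP: x_neq1; apply: val_inj.
have [q] : exists q, q \notin [:: inv_letter p; inv_letter f; last f t].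
  exact: exists_letter_notin.
rewrite !inE !negb_or => /and3P[q_p q_f q_l].
have red_g : reduced [:: inv_letter q; inv_letter p].
  by rewrite /reduced /= inv_letterK eq_sym q_p.
exists (FreeWord red_g), (q :: rcons (f :: t) (inv_letter q)).
have red_xg : reduced ((f :: t) ++ [:: inv_letter q; inv_letter p]).
  rewrite lastI; apply: reduced_cat; rewrite -?lastI//.
  by rewrite (inj_eq (inv_inj inv_letterK)).
rewrite conjgE !word_mul (mulw_reduced_cat red_xg).
rewrite /invw /= !inv_letterK.
have f_q : (f == inv_letter q) = false.
  by apply: contraNF q_f => /eqP ->; rewrite inv_letterK.
by rewrite f_q /= (negPf q_p) -cats1 -cat_rcons cats1.
Qed.

(** Take a conjugate of x of the form a ... a^-1 and a conjugate of y of the form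
    b ... b^-1. Neither of their two products cancels, and the products start
    with different letters. *)
Lemma exists_noncommuting_conj x y : x != 1 -> y != 1 ->
  exists g h, [~ x ^ g, y ^ h] != 1.
Proof.
move=> /(exists_conj_framed (false, false))[g [s xg_s]].
move=> /(exists_conj_framed (true, false))[h [t yh_t]].
exists g, h; apply/commgP => /(congr1 word).
have red_xg := word_reduced (x ^ g); have red_yh := word_reduced (y ^ h).
rewrite xg_s yh_t in red_xg red_yh.
rewrite (word_mul (x ^ g)) (word_mul (y ^ h)) xg_s yh_t.
by rewrite !mulw_reduced_cat// -rcons_cons reduced_cat.
Qed.

Lemma word_mapV (G : groupType) (u v : G) w :
  word_map w^-1 u v = (word_map w u v)^-1.
Proof. by apply: (mulIg (word_map w u v)); rewrite -word_mapM !mulVg word_map1. Qed.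

Lemma word_mapJ (G : groupType) (u v : G) w z :
  word_map (w ^ z) u v = word_map w u v ^ word_map z u v.
Proof. by rewrite !conjgE !word_mapM word_mapV. Qed.

Lemma word_mapR (G : groupType) (u v : G) w z :
  word_map [~ w, z] u v = [~ word_map w u v, word_map z u v].
Proof. by rewrite !commgEl word_mapM word_mapV word_mapJ. Qed.

Lemma word_mapX (G : groupType) (u v : G) w k :
  word_map (w ^+ k) u v = word_map w u v ^+ k.
Proof. by elim: k => [|k IHk]; rewrite ?word_map1// !expgS word_mapM IHk. Qed.

Lemma word_expa k : word (F2_a ^+ k) = nseq k (false, false).
Proof. by elim: k => // k IHk; rewrite expgS /= IHk; case: k {IHk}. Qed.

End FreeGroup.

(** * Words with small values *)

Section AlmostLaws.
Variables (R : realType) (n : nat).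
Implicit Types (u v : unitary R n) (w z : F2).

Lemma exists_commutator_word w z : w != 1%g -> z != 1%g ->
  exists2 c : F2, c != 1%g & forall u v, dist1 (word_map c u v)
    <= 2 * (dist1 (word_map w u v) * dist1 (word_map z u v)).
Proof.
move=> w1 z1; have [g [h gh1]] := exists_noncommuting_conj w1 z1.
exists [~ w ^ g, z ^ h]%g => // u v.
rewrite word_mapR !word_mapJ; apply: le_trans (dist1R _ _) _.
apply: ler_wpM2l; first exact: ler0n.
apply: ler_pM (dist1J _ _) (dist1J _ _); exact: dist1_ge0.
Qed.

(** Squaring beats the factor 2 of [dist1R] as soon as the distance is at most
    1/4: then 2 d^2 <= d / 2, so taking a commutator of two conjugates of the
    current word halves the bound. *)
Lemma exists_contracting_word w t : w != 1%g ->
  exists z : F2, z != 1%g /\ forall u v,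
    dist1 (word_map w u v) <= 4^-1 -> dist1 (word_map z u v) <= 4^-1 / 2 ^+ t.
Proof.
move=> w1; elim: t => [|t [z [z1 le_z]]].
  by exists w; split=> // u v; rewrite divr1.
have [c c1 le_c] := exists_commutator_word z1 z1.
exists c; split=> // u v /le_z {}le_z; apply: le_trans (le_c u v) _.
set d := dist1 _ in le_z *; have d_ge0 : 0 <= d := dist1_ge0 _.
have d_le4 : d <= 4^-1.
  apply: le_trans le_z _; rewrite ler_pdivrMr ?exprn_gt0 ?ltr0n//.
  by rewrite ler_peMr ?invr_ge0 ?ler0n// exprn_ege1// ler1n.
have -> : 4^-1 / 2 ^+ t.+1 = 2 * (4^-1 * (4^-1 / 2 ^+ t)) :> R.
  by rewrite exprS; field; rewrite expf_neq0 ?pnatr_eq0.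
by rewrite ler_wpM2l// ler_pM.
Qed.

(** One of the two factors in [dist1R] is bounded by 2, so a commutator is small
    wherever one of its two entries is small. An iterated commutator of conjugates
    of the given words is therefore small wherever one of these words is; each
    nesting costs a factor 4. *)
Lemma exists_dominated_word (c : nat -> F2) m : (forall k, c k != 1%g) ->
  exists2 z : F2, z != 1%g & forall u v k, (k < m)%N ->
    dist1 (word_map z u v) <= 4 ^+ m * dist1 (word_map (c k) u v).
Proof.
move=> c1; elim: m => [|m [z z1 le_z]]; first by exists F2_a.
(* The bound 2 on the distance absorbs the entry other than the word for k. *)
have [w w1 le_w] := exists_commutator_word z1 (c1 m).
exists w => // u v k; rewrite ltnS leq_eqVlt => lt_km; apply: le_trans (le_w u v) _.
have le_zc (a b : R) : 0 <= a -> 0 <= b <= 2 -> 2 * (a * b) <= 4 * a.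
  move=> a_ge0 /andP[b_ge0 b_le2].
  by rewrite (_ : 4 * a = 2 * (a * 2)) ?ler_wpM2l//; ring.
case/orP: lt_km => [/eqP->|lt_km].
  rewrite [_ * dist1 (word_map (c m) u v)]mulrC.
  apply: le_trans (le_zc _ _ (dist1_ge0 _) _) _.
    by rewrite dist1_ge0 dist1_le2.
  by rewrite ler_wpM2r ?dist1_ge0// exprS ler_peMr// exprn_ege1// ler1n.
apply: le_trans (le_zc _ _ (dist1_ge0 _) _) _.
  by rewrite dist1_ge0 dist1_le2.
by rewrite exprS -mulrA ler_wpM2l// le_z.
Qed.

End AlmostLaws.

Theorem corollary1p2 (R : realType) (n : nat) (eps : R) (eps_gt0 : 0 < eps) :
  exists2 w : F2, w != 1%g &
    forall u v : unitary R n, opnorm (1%:M - umx (word_map w u v)) <= eps.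
Proof.
have [m rec] : exists m, forall u : unitary R n, exists2 k,
    (0 < k <= m)%N & dist1 (u ^+ k)%g <= 4^-1.
  by apply: dist1_expg_le; rewrite invr_gt0.
(* Chosen so that 4^m / 2^t <= eps, because t < 2^t. *)
pose t := (Num.truncn (4 ^+ m / eps)).+1.
have power_neq1 k : (F2_a ^+ k.+1)%g != 1%g.
  by apply/eqP => /(congr1 word); rewrite word_expa.
(* Indices are shifted: c k is obtained from a^(k+1). *)
have /choice[c cP] k := exists_contracting_word R n t (power_neq1 k).
have [w w1 le_w] := exists_dominated_word R n m (fun k => (cP k).1).
exists w => // u v; have [[//|k] /= le_km le_k] := rec u.
apply: le_trans (le_w u v k le_km) _.
have {}le_k : dist1 (word_map (c k) u v) <= 4^-1 / 2 ^+ t.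
  by apply: (cP k).2; rewrite word_mapX word_map_a.
have pow_gt0 : 0 < 2 ^+ t :> R by rewrite exprn_gt0.
apply: (@le_trans _ _ (4 ^+ m / 2 ^+ t)).
  rewrite ler_wpM2l ?exprn_ge0//; apply: le_trans le_k _.
  by rewrite ler_piMl ?invr_ge0 ?ltW// invf_lt1// ltr1n.
rewrite ler_pdivrMr// mulrC -ler_pdivrMr// ltW//.
apply: lt_le_trans (truncnS_gt _) _.
by rewrite -(natrX R 2 t) ler_nat ltnW// ltn_expl.
Qed.
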